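(* Let $E$ be a Banach lattice and let $K \subset E$ be absolutely weakly compact. Then $K$ is absolutely weakly sequentially compact.
   Context: Banach lattices are real; $E^*$ denotes the topological dual of $E$. The absolute weak topology $|\sigma|(E,E^* )$ on a Banach lattice $E$ is the locally convex-solid topology generated by the lattice seminorms $p_{x^*}(x) = |x^*|(|x|)$, $x \in E$, where $x^*$ ranges over $E^*$. A subset $K$ of $E$ is absolutely weakly compact if it is compact for $|\sigma|(E,E^* )$; it is absolutely weakly sequentially compact if every sequence in $K$ has a subsequence that converges in $|\sigma|(E,E^* )$ to an element of $K$. *)

(* Defs.v *)
From HB Require Import structures.
From mathcomp Require Import all_boot all_order all_algebra.
From mathcomp Require Import all_classical all_reals all_analysis.

Set Implicit Arguments.
Unset Strict Implicit.
Unset Printing Implicit Defensive.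

Import Order.TTheory GRing.Theory Num.Theory.
Import numFieldNormedType.Exports.

Local Open Scope classical_set_scope.
Local Open Scope ring_scope.

(* The order is given by raw fields because Hierarchy Builder cannot join
   [Order.Lattice] with [CompleteNormedModule]; every Banach lattice is equipped
   with the library's lattice structure just below. *)
HB.mixin Record isBanachLattice (R : realType) E
    & CompleteNormedModule R E := {
  bl_le : rel E ;
  bl_meet : E -> E -> E ;
  bl_join : E -> E -> E ;
  bl_le_refl : reflexive bl_le ;
  bl_le_anti : antisymmetric bl_le ;
  bl_le_trans : transitive bl_le ;
  bl_meetP : forall x y z : E,
    bl_le x (bl_meet y z) = bl_le x y && bl_le x z ;
  bl_joinP : forall x y z : E,
    bl_le (bl_join x y) z = bl_le x z && bl_le y z ;
  bl_leD2r : forall z x y : E, bl_le x y -> bl_le (x + z) (y + z) ;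
  bl_scale_ge0 : forall (a : R) (x : E),
    0 <= a -> bl_le 0 x -> bl_le 0 (a *: x) ;
  bl_le_norm : forall x y : E,
    bl_le (bl_join x (- x)) (bl_join y (- y)) -> `|x| <= `|y|
}.

#[short(type="banachLatticeType")]
HB.structure Definition BanachLattice (R : realType) :=
  {E of CompleteNormedModule R E & isBanachLattice R E}.

#[non_forgetful_inheritance]
HB.instance Definition _ (R : realType) (E : banachLatticeType R) :=
  Order.Le_isPOrder.Build ring_display (BanachLattice.sort E)
    bl_le_refl bl_le_anti bl_le_trans.
#[non_forgetful_inheritance]
HB.instance Definition _ (R : realType) (E : banachLatticeType R) :=
  Order.POrder_MeetJoin_isLattice.Build ring_display (BanachLattice.sort E)
    bl_meetP bl_joinP.

(* The modulus of a vector; [`|x|] is its norm. *)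
Definition modulus (R : realType) (E : banachLatticeType R) (x : E) : E :=
  Order.join x (- x).

Record dual (R : realType) (E : banachLatticeType R) := Dual {
  dual_fun :> {scalar E} ;
  dual_continuous : continuous dual_fun }.

HB.instance Definition _ (R : realType) (E : banachLatticeType R) :=
  gen_eqMixin (dual E).
HB.instance Definition _ (R : realType) (E : banachLatticeType R) :=
  gen_choiceMixin (dual E).

Definition dual0 (R : realType) (E : banachLatticeType R) : dual E :=
  @Dual R E \0 (fun x => @cst_continuous _ _ (0 : R) x).

HB.instance Definition _ (R : realType) (E : banachLatticeType R) :=
  isPointed.Build (dual E) (dual0 E).

Definition dual_le (R : realType) (E : banachLatticeType R)
    (f g : E -> R) : Prop :=
  forall x : E, 0 <= x -> f x <= g x.

(* [m] is the least upper bound of [f] and [- f] in the dual. *)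
Definition is_dual_modulus (R : realType) (E : banachLatticeType R)
    (f m : dual E) : Prop :=
  [/\ dual_le f m, dual_le (fun x => - f x) m
    & forall g : dual E,
        dual_le f g -> dual_le (fun x => - f x) g -> dual_le m g].

(* By the Riesz-Kantorovich theorem the modulus exists and is unique, so the
   default value [dual0] of [xget] plays no role. *)
Definition dual_modulus (R : realType) (E : banachLatticeType R)
    (f : dual E) : dual E :=
  xget (dual0 E) [set m | is_dual_modulus f m].

Definition absw_seminorm (R : realType) (E : banachLatticeType R)
    (f : dual E) (x : E) : R :=
  dual_modulus f (modulus x).

(* [E] with the topology generated by the seminorms [absw_seminorm f]: the
   balls [[set y | absw_seminorm f (y - x) < e]], with [e > 0], form a
   subbase. *)
Definition absw (R : realType) (E : banachLatticeType R) : Type := E.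

HB.instance Definition _ (R : realType) (E : banachLatticeType R) :=
  Choice.copy (absw E) E.
HB.instance Definition _ (R : realType) (E : banachLatticeType R) :=
  @isSubBaseTopological.Build (absw E) (dual E * E * R)%type
    [set i | 0 < i.2]
    (fun i => [set y : E | absw_seminorm i.1.1 (y - i.1.2) < i.2]).

Definition absw_compact (R : realType) (E : banachLatticeType R)
    (K : set E) : Prop :=
  compact (K : set (absw E)).

Definition absw_seq_compact (R : realType) (E : banachLatticeType R)
    (K : set E) : Prop :=
  forall u : nat -> E, (forall n, K (u n)) ->
    exists phi : nat -> nat, {homo phi : m n / (m < n)%N} /\
      exists2 l : E, K l &
        (fun n => u (phi n) : absw E) @ \oo --> (l : absw E).

(* Main.v *)
From HB Require Import structures.
Require Import Defs.
From mathcomp Require Import all_boot all_order all_algebra.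
From mathcomp Require Import all_classical all_reals all_analysis.
From mathcomp Require Import ring lra.

(** The argument is the Smulian half of the Eberlein-Smulian theorem, carried
    out directly for the absolute weak topology.

    Every continuous functional [f] satisfies [`|f x| <= |f|(|x|)], hence is
    continuous for the absolute weak topology ([nbhs_absw]).  The seminorms are
    built from the modulus [|f|] in the dual, so this needs the
    Riesz-Kantorovich theorem ([riesz_kantorovich]): on the positive cone
    [|f|(x)] is the supremum of [f] over the order interval [[-x, x]], which
    is additive by the Riesz decomposition property.

    Let [u] be a sequence in [K] and [S] its norm-closed linear span.  By
    Hahn-Banach, a vector at positive distance from [S] is detected by a
    continuous functional vanishing on [S]; therefore every absolute weak
    cluster point of [u] lies in [S] ([absw_cluster_closed_span]).  As [S] is
    separable, countably many functionals [g k], norming the points of a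
    countable dense subset, separate the points of [S]
    ([countable_separating]).

    By compactness [u] has a cluster point [l] in [K].  Since [l] is a cluster
    point, a subsequence can be chosen along which each [g k] converges to
    [g k l] ([cluster_subsequence]).  A cluster point of this subsequence is in
    [S] and has the same values as [l] under all the [g k], so it is [l]; and in
    a compact set a filter with a single cluster point converges to it
    ([cvg_unique_cluster]). *)

Set Implicit Arguments.
Unset Strict Implicit.
Unset Printing Implicit Defensive.

Import Order.TTheory GRing.Theory Num.Theory.
Import numFieldNormedType.Exports.

Local Open Scope classical_set_scope.
Local Open Scope ring_scope.

(** * The Hahn-Banach theorem *)

Definition sublinear (R : realType) (V : lmodType R) (q : V -> R) : Prop :=
  (forall x y, q (x + y) <= q x + q y) /\
  (forall t x, 0 <= t -> q (t *: x) = t * q x).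

Lemma sublinear0 (R : realType) (V : lmodType R) (q : V -> R) :
  sublinear q -> q 0 = 0.
Proof. by move=> [_ qZ]; rewrite -(scale0r (0 : V)) qZ// mul0r. Qed.

Lemma sublinear_ge_opp (R : realType) (V : lmodType R) (q : V -> R) x :
  sublinear q -> - q (- x) <= q x.
Proof.
move=> sq; have := sq.1 x (- x); rewrite subrr sublinear0//; lra.
Qed.

(** The inequality for positive scalars suffices: applied to the inverse
    scalar it gives the reverse one. *)
Lemma sublinearI (R : realType) (V : lmodType R) (q : V -> R) :
  (forall x y, q (x + y) <= q x + q y) -> q 0 = 0 ->
  (forall t x, 0 < t -> q (t *: x) <= t * q x) -> sublinear q.
Proof.
move=> qD q0 qZ; split=> // t x; rewrite le_eqVlt => /orP[/eqP<-|t0].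
  by rewrite scale0r mul0r.
apply/eqP; rewrite eq_le qZ//= -ler_pdivlMl//.
have := qZ t^-1 (t *: x).
by rewrite invr_gt0 scalerA mulVf ?gt_eqF// scale1r; exact.
Qed.

(** For sublinear [q], the largest sublinear functional below [q] that takes
    the value [- q y] at [- y], as a linear one with value [q y] at [y] must. *)
Definition straighten (R : realType) (V : lmodType R) (y : V) (q : V -> R)
    (x : V) : R :=
  inf [set q (x + t *: y) - t * q y | t in [set t : R | 0 <= t]].

Lemma straighten_ge (R : realType) (V : lmodType R) (y : V) (q : V -> R) x c :
  (forall t, 0 <= t -> c <= q (x + t *: y) - t * q y) ->
  c <= straighten y q x.
Proof.
move=> cq; apply: lb_le_inf; first by exists (q (x + 0 *: y) - 0 * q y), 0 => /=.
by move=> _ [t /= t0 <-]; exact: cq.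
Qed.

(** The infimum is over a set bounded below by [- q (- x)], by
    subadditivity at [(x + t *: y) + (- x)]. *)
Lemma straighten_le (R : realType) (V : lmodType R) (y : V) (q : V -> R) x t :
  sublinear q -> 0 <= t -> straighten y q x <= q (x + t *: y) - t * q y.
Proof.
move=> sq t0; apply: ge_inf; last by exists t.
exists (- q (- x)) => _ [s /= s0 <-].
have := sq.1 (x + s *: y) (- x).
rewrite addrAC subrr add0r sq.2//; lra.
Qed.

(** Parameters [s] for [x1] and [t] for [x2] combine into [s + t] for
    [x1 + x2], and scaling [x] by [t] turns the parameter [s] into [t * s]. *)
Lemma straighten_sublinear (R : realType) (V : lmodType R) (y : V)
    (q : V -> R) : sublinear q -> sublinear (straighten y q).
Proof.
move=> sq.
have s00 : straighten y q 0 = 0.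
  apply/eqP; rewrite eq_le; apply/andP; split.
    have := straighten_le y 0 sq (lexx 0).
    by rewrite scale0r addr0 mul0r subr0 (sublinear0 sq).
  by apply: straighten_ge => t t0; rewrite add0r sq.2// subrr.
apply: sublinearI => // [x1 x2|t x t0].
- rewrite -lerBlDr; apply: straighten_ge => s s0.
  rewrite lerBlDl -lerBlDr; apply: straighten_ge => t t0.
  rewrite lerBlDl.
  apply: (le_trans (straighten_le y (x1 + x2) sq (addr_ge0 s0 t0))).
  have -> : x1 + x2 + (s + t) *: y = (x1 + s *: y) + (x2 + t *: y).
    by rewrite scalerDl addrACA.
  have := sq.1 (x1 + s *: y) (x2 + t *: y); lra.
- rewrite -ler_pdivrMl//; apply: straighten_ge => s s0.
  rewrite ler_pdivrMl//.
  apply: (le_trans (straighten_le y _ sq (mulr_ge0 (ltW t0) s0))).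
  by rewrite -scalerA -scalerDr (sq.2 _ _ (ltW t0)) mulrBr mulrA.
Qed.

Lemma straighten_le_id (R : realType) (V : lmodType R) (y : V) (q : V -> R) x :
  sublinear q -> straighten y q x <= q x.
Proof.
move=> sq; have := straighten_le y x sq (lexx 0).
by rewrite scale0r addr0 mul0r subr0.
Qed.

(** Zorn's lemma: the pointwise infimum of a chain is subadditive because two
    members of the chain can be replaced by the smaller one, and it is finite
    because all members dominate [x |-> - p (- x)]. *)
Lemma ex_minimal_sublinear (R : realType) (V : lmodType R) (p : V -> R) :
  sublinear p ->
  exists q : V -> R, [/\ sublinear q, forall x, q x <= p x &
    forall r : V -> R, sublinear r -> (forall x, r x <= q x) ->
      forall x, q x <= r x].
Proof.
move=> sp; pose S := {q : V -> R | sublinear q /\ forall x, q x <= p x}.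
pose le_S (q r : S) := `[< forall x, sval r x <= sval q x >].
have p0 : S by exists p.
have [| | |q qmin] := @ZL_preorder S p0 le_S.
- by move=> q; apply/asboolP.
- move=> q1 q2 q3 /asboolP h12 /asboolP h23; apply/asboolP => x.
  exact: le_trans (h23 x) (h12 x).
- move=> A totA.
  have [A0|/set0P[a Aa]] := eqVneq A set0.
    by exists p0 => s; rewrite A0.
  pose r x := inf [set sval q x | q in A].
  have r_ge x c : (forall q : S, A q -> c <= sval q x) -> c <= r x.
    move=> cq; apply: lb_le_inf; first by exists (sval a x), a.
    by move=> _ [q Aq <-]; exact: cq.
  have r_le x (q : S) : A q -> r x <= sval q x.
    move=> Aq; apply: ge_inf; last by exists q.
    exists (- p (- x)) => _ [[s [ss sp']] As /= <-].
    apply: le_trans (sublinear_ge_opp x ss).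
    by rewrite lerN2.
  have sr : sublinear r.
    apply: sublinearI => [x y||t x t0].
    + rewrite -lerBlDr; apply/r_ge => q1 Aq1.
      rewrite lerBlDl -lerBlDr; apply/r_ge => q2 Aq2; rewrite lerBlDl.
      have [/asboolP h|/asboolP h] := totA _ _ Aq1 Aq2.
      * apply: (le_trans (r_le _ _ Aq2)).
        apply: (le_trans ((svalP q2).1.1 x y)).
        by rewrite lerD2r h.
      * apply: (le_trans (r_le _ _ Aq1)).
        apply: (le_trans ((svalP q1).1.1 x y)).
        by rewrite lerD2l h.
    + apply/eqP; rewrite eq_le; apply/andP; split.
        by rewrite -(sublinear0 (svalP a).1) r_le.
      by apply: r_ge => q _; rewrite (sublinear0 (svalP q).1).
    + rewrite -ler_pdivrMl//; apply: r_ge => q Aq; rewrite ler_pdivrMl//.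
      by rewrite -((svalP q).1.2 _ _ (ltW t0)) r_le.
  have rp x : r x <= p x by apply: le_trans ((svalP a).2 x); exact: r_le.
  exists (exist _ r (conj sr rp)) => q Aq; apply/asboolP => x /=.
  exact: r_le.
exists (sval q); split; [exact: (svalP q).1|exact: (svalP q).2|].
move=> r sr rq.
have rp x : r x <= p x by exact: le_trans (rq x) ((svalP q).2 x).
have /asboolP : le_S (exist _ r (conj sr rp)) q by apply: qmin; apply/asboolP.
exact.
Qed.

(** A minimal sublinear functional [q] coincides with each of its
    straightenings, which at parameter [1] reads [q x <= q (x + y) - q y]. *)
Lemma ex_linear_le_sublinear (R : realType) (V : lmodType R) (p : V -> R) :
  sublinear p -> exists f : {scalar V}, forall x, f x <= p x.
Proof.
move=> /ex_minimal_sublinear[q [sq qp qmin]].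
have qD x y : q (x + y) = q x + q y.
  apply/eqP; rewrite eq_le sq.1/=.
  have := qmin _ (straighten_sublinear y sq) (fun z => straighten_le_id y z sq) x.
  move=> /le_trans/(_ (straighten_le y x sq ler01)).
  by rewrite scale1r mul1r lerBrDr.
have qN x : q (- x) = - q x.
  by apply/eqP; rewrite -addr_eq0 -qD addNr sublinear0.
have qlin : scalar q.
  move=> a x y; rewrite qD; congr (_ + _).
  have [a0|a0] := leP 0 a; first by rewrite sq.2.
  rewrite -[a]opprK scaleNr qN sq.2 ?mulNr//; lra.
pose f : {scalar V} := HB.pack q (GRing.isLinear.Build R V R *%R q qlin).
by exists f.
Qed.

(** A linear functional below the straightening of [p] along [x0] has value at
    most [- p x0] at [- x0], so no extension from a subspace is needed. *)
Lemma hahn_banach (R : realType) (V : lmodType R) (p : V -> R) (x0 : V) :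
  sublinear p -> exists2 f : {scalar V}, forall x, f x <= p x & f x0 = p x0.
Proof.
move=> sp.
have [f fp] := ex_linear_le_sublinear (straighten_sublinear x0 sp).
have fp' x : f x <= p x by exact: le_trans (fp x) (straighten_le_id x0 x sp).
exists f => //; apply/eqP; rewrite eq_le fp'/=.
have := le_trans (fp (- x0)) (straighten_le x0 (- x0) sp ler01).
by rewrite scale1r addNr sublinear0// mul1r sub0r linearN/= lerN2.
Qed.

(** * Continuous functionals on normed modules *)

Lemma continuous_of_le_norm (R : realType) (E : normedModType R)
    (f : {scalar E}) (c : R) : (forall x, f x <= c * `|x|) -> continuous f.
Proof.
move=> fc; have fb x : `|f x| <= c * `|x|.
  by rewrite ler_norml fc andbT lerNl -linearN/= -(normrN x).
apply: (@bounded_linear_continuous R E R^o f).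
apply/(@linear_boundedP R E R^o f); near=> r => x.
apply: (le_trans (fb x)); rewrite ler_wpM2r//.
Unshelve. all: by end_near. Qed.

Lemma bounded_of_continuous_scalar (R : realType) (E : normedModType R)
    (f : {scalar E}) : continuous f -> exists2 c : R, 0 <= c &
      forall x, `|f x| <= c * `|x|.
Proof.
move=> fc; have /(@linear_boundedP R E R^o f)/pinfty_ex_gt0[c c0 fb] :
    bounded_near (f : E -> R^o) (nbhs (0 : E)).
  exact/(@linear_bounded_continuous R E R^o f).
by exists c => //; exact: ltW.
Qed.

Lemma norming_functional (R : realType) (V : normedModType R) (x : V) :
  exists f : {scalar V}, [/\ continuous f, forall y, f y <= `|y| & f x = `|x|].
Proof.
have sn : sublinear (fun y : V => `|y|).
  by split=> [y z|t y t0]; rewrite ?ler_normD// normrZ ger0_norm.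
have [f fn fx] := hahn_banach x sn; exists f; split=> //.
by apply: (@continuous_of_le_norm _ _ _ 1) => y; rewrite mul1r.
Qed.

Lemma dist_sublinear (R : realType) (V : normedModType R) (S : set V) :
  S 0 -> (forall x y, S x -> S y -> S (x + y)) ->
  (forall (a : R) x, S x -> S (a *: x)) ->
  sublinear (fun x => inf [set `|x - y| | y in S]).
Proof.
move=> S0 SD SZ; set p := (fun x => _).
have p_le x y : S y -> p x <= `|x - y|.
  move=> Sy; apply: ge_inf; last by exists y.
  by exists 0 => _ [z _ <-].
have p_ge x c : (forall y, S y -> c <= `|x - y|) -> c <= p x.
  move=> cS; apply: lb_le_inf; first by exists `|x - 0|, 0.
  by move=> _ [y Sy <-]; exact: cS.
apply: sublinearI => [x y||t x t0].
- rewrite -lerBlDr; apply/p_ge => x' Sx'.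
  rewrite lerBlDl -lerBlDr; apply/p_ge => y' Sy'; rewrite lerBlDl.
  apply: (le_trans (p_le _ _ (SD _ _ Sx' Sy'))).
  by rewrite opprD addrACA; exact: ler_normD.
- apply/eqP; rewrite eq_le; apply/andP; split.
    by rewrite (le_trans (p_le 0 0 S0))// subrr normr0.
  by apply/p_ge => y _.
- rewrite -ler_pdivrMl//; apply/p_ge => y Sy; rewrite ler_pdivrMl//.
  apply: (le_trans (p_le _ _ (SZ t _ Sy))).
  by rewrite -scalerBr normrZ gtr0_norm.
Qed.

(** The functional is the Hahn-Banach one for the distance to [S]: it vanishes
    on [S] and its value at [x] is the distance of [x] to [S]. *)
Lemma subspace_separation (R : realType) (V : normedModType R) (S : set V)
    (x : V) : S 0 -> (forall x y, S x -> S y -> S (x + y)) ->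
  (forall (a : R) x, S x -> S (a *: x)) ->
  (forall f : {scalar V}, continuous f -> (forall y, S y -> f y = 0) ->
    f x = 0) ->
  closure S x.
Proof.
move=> S0 SD SZ Sx.
have [f fp fx] := hahn_banach x (dist_sublinear S0 SD SZ).
have p_le (z y : V) : S y -> f z <= `|z - y|.
  move=> Sy; apply: (le_trans (fp z)); apply: ge_inf; last by exists y.
  by exists 0 => _ [t _ <-].
have f0 y : S y -> f y = 0.
  move=> Sy; apply/eqP; rewrite eq_le; apply/andP; split.
    by have := p_le y y Sy; rewrite subrr normr0.
  have := p_le (- y) _ (SZ (-1) _ Sy).
  by rewrite scaleN1r subrr normr0 linearN/= oppr_le0.
have fc : continuous f.
  apply: (@continuous_of_le_norm _ _ _ 1) => z.
  by rewrite mul1r; have := p_le z 0 S0; rewrite subr0.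
move: fx; rewrite (Sx f fc f0) => px.
move=> B /nbhs_normP[e /= e0 eB].
have [_ [y Sy <-] ye] : exists2 t, [set `|x - y| | y in S] t & t < e.
  have inf_x : has_inf [set `|x - y| | y in S].
    by split; [exists `|x - 0|, 0|exists 0 => _ [y _ <-]].
  by have [t St tE] := inf_adherent e0 inf_x; exists t; rewrite // -[e]add0r px.
by exists y; split=> //; exact: eB.
Qed.

(** * Rational spans of sequences *)

(** Lists form a countable index type on which the addition of combinations
    is concatenation. *)
Definition rat_comb (R : realType) (V : lmodType R) (u : nat -> V)
    (s : seq (rat * nat)) : V :=
  \sum_(a <- s) ratr a.1 *: u a.2.

Lemma rat_comb_seq (R : realType) (V : lmodType R) (u : nat -> V) n :
  range (rat_comb u) (u n).
Proof.
by exists [:: (1, n)] => //; rewrite /rat_comb big_seq1 rmorph1 scale1r.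
Qed.

(** Density of the rationals in the reals makes the closure of the rational
    span a real subspace. *)
Lemma closure_rat_comb_subspace (R : realType) (V : normedModType R)
    (u : nat -> V) (S := closure (range (rat_comb u))) :
  [/\ S 0, forall x y, S x -> S y -> S (x + y) &
      forall (a : R) x, S x -> S (a *: x)].
Proof.
have SE x : S x <-> forall e : R, 0 < e -> exists s, `|x - rat_comb u s| < e.
  split=> [Sx e e0|Sx B /nbhs_normP[e /= e0 eB]].
    have [_ [[s _ <-] se]] := Sx _ (nbhsx_ballx x e e0).
    by exists s; move: se; rewrite -ball_normE.
  by have [s xs] := Sx e e0; exists (rat_comb u s); split; [exists s|exact: eB].
split=> [|x y /SE Sx /SE Sy|a x /SE Sx]; apply/SE => e e0.
- by exists [::]; rewrite /rat_comb big_nil subrr normr0.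
- have e2 : 0 < e / 2 by rewrite divr_gt0.
  have [s xs] := Sx _ e2; have [t yt] := Sy _ e2.
  exists (s ++ t); rewrite /rat_comb big_cat/= opprD addrACA.
  apply: (le_lt_trans (ler_normD _ _)); rewrite /rat_comb in xs yt; lra.
- have d0 : 0 < e / (2 * (`|a| + 1)) by rewrite divr_gt0// mulr_gt0// ltr_wpDl.
  have [s xs] := Sx _ d0; set v := rat_comb u s in xs.
  have c0 : 0 < e / (2 * (`|v| + 1)) by rewrite divr_gt0// mulr_gt0// ltr_wpDl.
  have /rat_in_itvoo[q] : a < a + e / (2 * (`|v| + 1)) by rewrite ltrDl.
  rewrite in_itv/= => /andP[aq qa].
  exists [seq (q * b.1, b.2) | b <- s].
  have -> : rat_comb u [seq (q * b.1, b.2) | b <- s] = ratr q *: v.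
    rewrite /v /rat_comb big_map scaler_sumr; apply: eq_bigr => b _ /=.
    by rewrite rmorphM/= scalerA.
  have -> : a *: x - ratr q *: v = a *: (x - v) + (a - ratr q) *: v.
    by rewrite scalerBr scalerBl addrA subrK.
  apply: (le_lt_trans (ler_normD _ _)); rewrite !normrZ.
  have h1 : `|a| * `|x - v| <= e / 2.
    apply: (@le_trans _ _ ((`|a| + 1) * (e / (2 * (`|a| + 1))))).
      by apply: ler_pM => //; [rewrite lerDl|exact: ltW].
    have : `|a| + 1 != 0 by rewrite gt_eqF// ltr_wpDl.
    move=> ?; rewrite le_eqVlt; apply/orP; left; apply/eqP; field.
    by [].
  have h2 : `|a - ratr q| * `|v| < e / 2.
    apply: (@le_lt_trans _ _ (e / (2 * (`|v| + 1)) * `|v|)).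
      by apply: ler_wpM2r => //; rewrite distrC gtr0_norm ?subr_gt0// lerBlDl ltW.
    rewrite mulrAC ltr_pdivrMr ?mulr_gt0 ?ltr_wpDl//.
    have := normr_ge0 v; nra.
  lra.
Qed.

(** * Order and modulus in a Banach lattice *)

Lemma bl_lerD2r (R : realType) (E : banachLatticeType R) (z x y : E) :
  (x + z <= y + z) = (x <= y).
Proof.
apply/idP/idP => [|xy]; last exact: (bl_leD2r z).
by move=> /(bl_leD2r (- z)); rewrite !addrK.
Qed.

Lemma bl_lerD (R : realType) (E : banachLatticeType R) (x y z t : E) :
  x <= y -> z <= t -> x + z <= y + t.
Proof.
move=> xy zt; apply: (@le_trans _ _ (y + z)); first by rewrite bl_lerD2r.
by rewrite ![y + _]addrC bl_lerD2r.
Qed.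

Lemma bl_lerN2 (R : realType) (E : banachLatticeType R) (x y : E) :
  (- x <= - y) = (y <= x).
Proof. by rewrite -(bl_lerD2r (x + y) (- x)) addKr addrCA addNr addr0. Qed.

Lemma bl_lerBlDr (R : realType) (E : banachLatticeType R) (x y z : E) :
  (x - z <= y) = (x <= y + z).
Proof. by rewrite -(bl_lerD2r z (x - z)) subrK. Qed.

Lemma bl_subr_ge0 (R : realType) (E : banachLatticeType R) (x y : E) :
  (0 <= y - x) = (x <= y).
Proof. by rewrite -(bl_lerD2r x 0) subrK add0r. Qed.

Lemma bl_lerZ (R : realType) (E : banachLatticeType R) (a : R) (x y : E) :
  0 <= a -> x <= y -> a *: x <= a *: y.
Proof.
move=> a0; rewrite -bl_subr_ge0 -[_ <= a *: y]bl_subr_ge0 -scalerBr.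
exact: bl_scale_ge0.
Qed.

Lemma modulus_le (R : realType) (E : banachLatticeType R) (x y : E) :
  (modulus x <= y) = (x <= y) && (- y <= x).
Proof. by rewrite /modulus leUx -[- x <= y]bl_lerN2 opprK. Qed.

Lemma le_modulus (R : realType) (E : banachLatticeType R) (x : E) :
  x <= modulus x.
Proof. exact: leUl. Qed.

Lemma leN_modulus (R : realType) (E : banachLatticeType R) (x : E) :
  - x <= modulus x.
Proof. exact: leUr. Qed.

Lemma modulusN (R : realType) (E : banachLatticeType R) (x : E) :
  modulus (- x) = modulus x.
Proof. by rewrite /modulus opprK joinC. Qed.

(** Twice the modulus dominates [x - x]. *)
Lemma modulus_ge0 (R : realType) (E : banachLatticeType R) (x : E) :
  0 <= modulus x.
Proof.
have h : 0 <= 2%:R *: modulus x.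
  rewrite scaler_nat mulr2n -(addrN x).
  exact: bl_lerD (le_modulus x) (leN_modulus x).
have half0 : 0 <= 2^-1 :> R by rewrite invr_ge0.
by have := bl_lerZ half0 h; rewrite scaler0 scalerA mulVf ?scale1r// pnatr_eq0.
Qed.

Lemma modulus_id (R : realType) (E : banachLatticeType R) (x : E) :
  0 <= x -> modulus x = x.
Proof.
move=> x0; apply: le_anti; rewrite le_modulus modulus_le lexx/= andbT.
by apply: (le_trans _ x0); rewrite -oppr0 bl_lerN2.
Qed.

Lemma modulus0 (R : realType) (E : banachLatticeType R) :
  modulus (0 : E) = 0.
Proof. exact: modulus_id. Qed.

Lemma norm_modulus_le (R : realType) (E : banachLatticeType R) (x y : E) :
  modulus x <= modulus y -> `|x| <= `|y|.
Proof. exact: bl_le_norm. Qed.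

Lemma norm_modulus (R : realType) (E : banachLatticeType R) (x : E) :
  `|modulus x| = `|x|.
Proof.
by apply: le_anti; rewrite !norm_modulus_le ?(modulus_id (modulus_ge0 x)) ?lexx.
Qed.

(** The witness is the truncation of [y] to the order interval
    [[- x1, x1]]. *)
Lemma riesz_decomposition (R : realType) (E : banachLatticeType R)
    (x1 x2 y : E) : 0 <= x1 -> 0 <= x2 -> modulus y <= x1 + x2 ->
  exists2 z : E, modulus z <= x1 & modulus (y - z) <= x2.
Proof.
move=> x1_ge0 x2_ge0; rewrite modulus_le => /andP[yle yge].
have Nx1 : - x1 <= x1 by apply: (@le_trans _ _ 0); rewrite // -oppr0 bl_lerN2.
have yx2 : y <= y + x2 by rewrite -[leLHS]addr0 bl_lerD.
exists (Order.join (Order.meet y x1) (- x1)).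
  by rewrite modulus_le leUx leIr Nx1 leUr.
rewrite modulus_le; apply/andP; split.
  rewrite bl_lerBlDr addrC -bl_lerBlDr; apply: le_trans (leUl _ _).
  by rewrite lexI !bl_lerBlDr yle yx2.
rewrite -[_ <= y - _]bl_lerN2 opprB opprK bl_lerBlDr leUx addrC.
rewrite (le_trans (leIl _ _) yx2)/=.
by rewrite -(bl_lerD2r (- x2)) -opprD addrK.
Qed.

(** * The modulus of a functional *)

(** Since [x + y] and [x - y] are positive, [f (x + y) <= g (x + y)] and
    [- f (x - y) <= g (x - y)]; the sum of these is [2 f y <= 2 g x].  This
    gives both the minimality of the modulus of [f] and the continuity of [f]
    for the seminorm it defines. *)
Lemma dual_dominated (R : realType) (E : banachLatticeType R) (f g : dual E)
    (x y : E) : dual_le f g -> dual_le (fun z => - f z) g ->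
  modulus y <= x -> f y <= g x.
Proof.
move=> fg Nfg; rewrite modulus_le => /andP[yx Nxy].
have xy0 : 0 <= y + x by rewrite -[x]opprK bl_subr_ge0.
have yx0 : 0 <= x - y by rewrite bl_subr_ge0.
have := fg _ xy0; have := Nfg _ yx0; rewrite !linearD !linearN/=; lra.
Qed.

(** The Riesz-Kantorovich formula, meaningful for [x] in the positive cone. *)
Definition cone_modulus (R : realType) (E : banachLatticeType R) (f : dual E)
    (x : E) : R :=
  sup [set f y | y in [set y : E | modulus y <= x]].

Lemma cone_modulus_le (R : realType) (E : banachLatticeType R) (f : dual E)
    (x : E) (b : R) :
  0 <= x -> (forall y, modulus y <= x -> f y <= b) -> cone_modulus f x <= b.
Proof.
move=> x0 fb; apply: ge_sup; last by move=> _ [y yx <-]; exact: fb.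
by exists (f 0), 0; rewrite //= modulus0.
Qed.

Lemma dual_le_norm_interval (R : realType) (E : banachLatticeType R) (f : dual E) :
  exists2 c : R, 0 <= c & forall x y, modulus y <= x -> f y <= c * `|x|.
Proof.
have [c c0 fc] := bounded_of_continuous_scalar (@dual_continuous _ _ f).
exists c => // x y yx; apply: (le_trans (ler_norm _)).
apply: (le_trans (fc y)); apply: ler_wpM2l => //.
by apply: norm_modulus_le; exact: le_trans yx (le_modulus x).
Qed.

Lemma cone_modulus_ge (R : realType) (E : banachLatticeType R) (f : dual E)
    (x y : E) : modulus y <= x -> f y <= cone_modulus f x.
Proof.
move=> yx; apply: ub_le_sup; last by exists y.
have [c _ fc] := dual_le_norm_interval f.
by exists (c * `|x|) => _ [z zx <-]; exact: fc.
Qed.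

Lemma cone_modulus_ge0 (R : realType) (E : banachLatticeType R) (f : dual E)
    (x : E) : 0 <= x -> 0 <= cone_modulus f x.
Proof.
by move=> x0; rewrite -(linear0 f); apply: cone_modulus_ge; rewrite modulus0.
Qed.

(** The nontrivial inequality is the Riesz decomposition of an element of the
    order interval of [x + y]. *)
Lemma cone_modulusD (R : realType) (E : banachLatticeType R) (f : dual E)
    (x y : E) : 0 <= x -> 0 <= y ->
  cone_modulus f (x + y) = cone_modulus f x + cone_modulus f y.
Proof.
move=> x0 y0; have xy0 : 0 <= x + y by rewrite -(addr0 0) bl_lerD.
apply/eqP; rewrite eq_le; apply/andP; split.
  apply: cone_modulus_le => // z /(riesz_decomposition x0 y0)[z1 z1x z2y].
  by rewrite -(subrK z1 z) addrC linearD/= lerD// cone_modulus_ge.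
rewrite -lerBrDr; apply: cone_modulus_le => // z1 z1x.
rewrite lerBrDr addrC -lerBrDr; apply: cone_modulus_le => // z2 z2y.
rewrite lerBrDr addrC -linearD/=; apply: cone_modulus_ge.
move: z1x z2y; rewrite !modulus_le opprD => /andP[? ?] /andP[? ?].
by rewrite !bl_lerD.
Qed.

Lemma cone_modulusZ (R : realType) (E : banachLatticeType R) (f : dual E)
    (a : R) (x : E) : 0 <= a -> 0 <= x ->
  cone_modulus f (a *: x) = a * cone_modulus f x.
Proof.
have cone_modulusZ_le (b : R) (z : E) : 0 < b -> 0 <= z ->
    cone_modulus f (b *: z) <= b * cone_modulus f z.
  move=> b0 z0; have bV0 : 0 <= b^-1 by rewrite invr_ge0 ltW.
  apply: cone_modulus_le => [|y]; first exact: bl_scale_ge0 (ltW b0) z0.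
  rewrite modulus_le => /andP[/(bl_lerZ bV0) yz /(bl_lerZ bV0)].
  rewrite scalerN; move: yz; rewrite scalerA mulVf ?gt_eqF// scale1r => yz zy.
  rewrite -ler_pdivrMl// -linearZ/=; apply: cone_modulus_ge.
  by rewrite modulus_le yz zy.
rewrite le_eqVlt => /orP[/eqP<- x0|a0 x0].
  have := cone_modulusD f (lexx 0) (lexx 0).
  rewrite scale0r mul0r addr0; lra.
have ax0 : 0 <= a *: x by apply: bl_scale_ge0 => //; exact: ltW.
apply/eqP; rewrite eq_le cone_modulusZ_le//= -ler_pdivlMl//.
have := cone_modulusZ_le a^-1 (a *: x).
by rewrite invr_gt0 scalerA mulVf ?gt_eqF// scale1r; exact.
Qed.

(** The additive map on the cone extends consistently to differences. *)
Lemma cone_modulusB (R : realType) (E : banachLatticeType R) (f : dual E)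
    (a b c d : E) : 0 <= a -> 0 <= b -> 0 <= c -> 0 <= d -> a - b = c - d ->
  cone_modulus f a - cone_modulus f b = cone_modulus f c - cone_modulus f d.
Proof.
move=> a0 b0 c0 d0 abcd.
have : a + d = c + b by rewrite -(subrK b a) abcd addrAC subrK.
move/(congr1 (cone_modulus f)); rewrite !cone_modulusD//; lra.
Qed.

(** Linearity forces the extension of the formula on the cone through any
    expression of [x] as a difference of positive vectors; the expression used
    here is [modulus x - (modulus x - x)]. *)
Definition modulus_extension (R : realType) (E : banachLatticeType R)
    (f : dual E) (x : E) : R :=
  cone_modulus f (modulus x) - cone_modulus f (modulus x - x).

Lemma modulus_extensionB (R : realType) (E : banachLatticeType R)
    (f : dual E) (a b : E) : 0 <= a -> 0 <= b ->
  modulus_extension f (a - b) = cone_modulus f a - cone_modulus f b.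
Proof.
move=> a0 b0; apply: cone_modulusB => //; first exact: modulus_ge0.
  by rewrite bl_subr_ge0 le_modulus.
by rewrite opprB addrC subrK.
Qed.

Lemma modulus_extension_scalar (R : realType) (E : banachLatticeType R)
    (f : dual E) : scalar (modulus_extension f).
Proof.
have m0 (x : E) : 0 <= modulus x - x by rewrite bl_subr_ge0 le_modulus.
have decomp (x : E) : x = modulus x - (modulus x - x).
  by rewrite opprB addrC subrK.
have addM x y : modulus_extension f (x + y) =
    modulus_extension f x + modulus_extension f y.
  rewrite {1}(decomp x) {1}(decomp y) addrACA -opprD modulus_extensionB.
  - rewrite (cone_modulusD f (m0 x) (m0 y)).
    rewrite (cone_modulusD f (modulus_ge0 x) (modulus_ge0 y)).
    rewrite /modulus_extension; lra.
  - by rewrite -(addr0 0) bl_lerD// modulus_ge0.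
  - by rewrite -(addr0 0) bl_lerD.
have oppM x : modulus_extension f (- x) = - modulus_extension f x.
  rewrite {1}(decomp x) opprB modulus_extensionB ?modulus_ge0//.
  by rewrite opprB.
have posM a x : 0 <= a ->
    modulus_extension f (a *: x) = a * modulus_extension f x.
  move=> a0; rewrite {1}(decomp x) scalerBr modulus_extensionB.
  - by rewrite !cone_modulusZ ?modulus_ge0// mulrBr.
  - exact: bl_scale_ge0 a0 (modulus_ge0 x).
  - exact: bl_scale_ge0 a0 (m0 x).
move=> a x y; rewrite addM; congr (_ + _).
have [a0|a0] := leP 0 a; first exact: posM.
rewrite -[a]opprK scaleNr oppM posM ?mulNr//; lra.
Qed.

(** The extension is continuous because at [x] it is at most its value at
    [modulus x], and it is the least upper bound because any upper bound of
    [f] and [- f] dominates [f] on order intervals. *)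
Lemma riesz_kantorovich (R : realType) (E : banachLatticeType R)
    (f : dual E) : exists m : dual E, is_dual_modulus f m.
Proof.
pose g : {scalar E} := HB.pack (modulus_extension f)
  (GRing.isLinear.Build R E R *%R (modulus_extension f)
    (modulus_extension_scalar f)).
have gE (x : E) : 0 <= x -> modulus_extension f x = cone_modulus f x.
  move=> x0; have := cone_modulusZ f (lexx 0) x0.
  rewrite scale0r mul0r => cm0.
  by rewrite -{1}[x]subr0 modulus_extensionB// cm0 subr0.
have [c c0 fc] := dual_le_norm_interval f.
have gc : continuous g.
  apply: (@continuous_of_le_norm _ _ _ c) => x.
  have : cone_modulus f (modulus x) <= c * `|x|.
    rewrite -norm_modulus; apply: cone_modulus_le; first exact: modulus_ge0.
    by move=> y; exact: fc.
  have : 0 <= cone_modulus f (modulus x - x).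
    by apply: cone_modulus_ge0; rewrite bl_subr_ge0 le_modulus.
  rewrite /= /modulus_extension; lra.
exists (Dual gc); split=> [x x0|x x0|h fh Nfh x x0] /=.
- by rewrite gE//; apply: cone_modulus_ge; rewrite modulus_id.
- rewrite gE// -linearN; apply: cone_modulus_ge.
  by rewrite modulusN modulus_id.
- rewrite gE//; apply: cone_modulus_le => // y.
  exact: dual_dominated.
Qed.

(** Together with linearity this makes [f] continuous for the absolute weak
    topology. *)
Lemma ler_absw_seminorm (R : realType) (E : banachLatticeType R) (f : dual E)
    (x : E) : `|f x| <= absw_seminorm f x.
Proof.
have [fle Nfle _] : is_dual_modulus f (dual_modulus f).
  exact: (xgetPex _ (riesz_kantorovich f)).
rewrite ler_norml lerNl -linearN/=; apply/andP; split.
  by apply: dual_dominated => //; rewrite modulusN.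
exact: dual_dominated.
Qed.

(** * Cluster points and subsequences *)

(** If [F] did not converge to [x], it would be frequently outside some
    neighbourhood [U] of [x]; its restriction to the complement of [U] would
    then have a cluster point in [K], which is a cluster point of [F] and
    differs from [x]. *)
Lemma cvg_unique_cluster (T : topologicalType) (F : set_system T)
    (K : set T) (x : T) : ProperFilter F -> compact K -> F K ->
  (forall y, cluster F y -> y = x) -> F --> x.
Proof.
move=> PF cK FK Fx U xU; rewrite nbhs_simpl; apply: contrapT => FU.
have PG : ProperFilter (within (~` U) F).
  apply: Build_ProperFilter_ex => A FA; apply: contrapT => A0.
  apply: FU; apply: (@filterS _ F _ _ _ _ FA) => y Ay; apply: contrapT => Uy.
  by apply: A0; exists y; exact: Ay.
have [|y [_ Gy]] := cK _ PG.
  by apply: filterS FK => y.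
have yx : y = x by apply: Fx; apply: cvg_cluster Gy; exact: cvg_within.
have [||z [Uz]] := Gy (~` U) U; [|by rewrite yx|exact].
by apply: (@filterE _ F) => z.
Qed.

Lemma cvg_increasing (phi : nat -> nat) :
  {homo phi : m n / (m < n)%N} -> phi @ \oo --> \oo.
Proof.
move=> phi_lt; have phi_ge n : (n <= phi n)%N.
  by elim: n => // n /leq_ltn_trans; apply; exact: phi_lt.
move=> A [N _ NA]; exists N => // n /= Nn.
exact: NA (leq_trans Nn (phi_ge n)).
Qed.

(** The [n]-th term of the subsequence is taken in the neighbourhood of [l] on
    which the first [n.+1] functions are within [1 / n.+1] of their value at
    [l]. *)
Lemma cluster_subsequence (R : realType) (T : topologicalType) (u : nat -> T)
    (l : T) (g : nat -> T -> R) :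
  (forall k e, 0 < e -> nbhs l [set y | `|g k y - g k l| < e]) ->
  cluster (u @ \oo) l ->
  exists2 phi : nat -> nat, {homo phi : m n / (m < n)%N} &
    forall k, (fun n => g k (u (phi n))) @ \oo --> g k l.
Proof.
move=> gl ul.
have /choice[s sP] : forall Nn : nat * nat, exists m, (Nn.1 < m)%N /\
    forall k, (k <= Nn.2)%N -> `|g k (u m) - g k l| < Nn.2.+1%:R^-1.
  move=> [N n] /=.
  have near_l : nbhs l [set y |
      forall k : 'I_n.+1, `|g k y - g k l| < n.+1%:R^-1].
    by apply: filter_forall => k; apply: gl; rewrite invr_gt0.
  have [|y [[m Nm <-] my]] := ul [set u m | m in [set m | (N < m)%N]] _ _ near_l.
    by exists N.+1 => // m /= Nm; exists m.
  by exists m; split=> // k kn; have := my (Ordinal (kn : (k < n.+1)%N)).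
(* [s (N, n)] is an index beyond [N] meeting the requirement of rank [n]. *)
pose phi := fix phi n :=
  if n is n'.+1 then s (phi n', n) else s (0%N, 0%N).
have phiP n k : (k <= n)%N -> `|g k (u (phi n)) - g k l| < n.+1%:R^-1.
  by case: n => [|n]; [have [_] := sP (0%N, 0%N)|have [_] := sP (phi n, n.+1)];
    exact.
exists phi.
  apply: homo_ltn; first exact: ltn_trans.
  by move=> n; have [] := sP (phi n, n.+1).
move=> k; apply/cvgrPdist_lt => e e0.
near=> n; rewrite distrC.
have kn : (k <= n)%N by near: n; exact: nbhs_infty_ge.
apply: (lt_trans (phiP n k kn)); near: n; exact: (near_infty_natSinv_lt (PosNum e0)).
Unshelve. all: by end_near. Qed.

(** * Sequential compactness for the absolute weak topology *)

Lemma nbhs_absw (R : realType) (E : banachLatticeType R) (f : dual E)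
    (x : E) (e : R) : 0 < e ->
  nbhs (x : absw E) [set y : absw E | `|f y - f x| < e].
Proof.
move=> e0; pose B := [set y : absw E | absw_seminorm f (y - x : E) < e].
have oB : open B.
  exists [set B]; last by rewrite bigcup_set1.
  by move=> _ ->; exact: (@finI_from1 _ _ _ _ (f, x, e)).
have Bx : B x.
  by rewrite /B /= subrr /absw_seminorm modulus0 linear0.
apply: (filterS _ (open_nbhs_nbhs (conj oB Bx))) => y /=.
apply: le_lt_trans; rewrite -linearB; exact: ler_absw_seminorm.
Qed.

(** Norm-closed subspaces are closed for the absolute weak topology, being
    intersections of kernels of continuous functionals. *)
Lemma absw_cluster_closed_span (R : realType) (E : banachLatticeType R)
    (u : nat -> E) (l : absw E) :
  cluster ((u : nat -> absw E) @ \oo) l -> closure (range (rat_comb u)) (l : E).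
Proof.
move=> ul; have [S0 SD SZ] := closure_rat_comb_subspace u.
rewrite ((closure_id _).1 (@closed_closure _ (range (rat_comb u)))).
apply: subspace_separation => // f fc f0.
apply/eqP; apply: contrapT => /negP fl0; rewrite -normr_gt0 in fl0.
have [|y [[n _ <-]]] := ul (range (u : nat -> absw E)) _ _
    (nbhs_absw (Dual fc) l fl0).
  by exists 0%N => // n _; exists n.
rewrite /= (f0 (u n)) ?sub0r ?normrN ?ltxx//.
by apply: subset_closure; exact: rat_comb_seq.
Qed.

(** For each rational combination [d] take a functional of norm at most one
    with value [`|d|] at [d].  If all of them vanish at [z] and [d] is within
    [e] of [z], then [`|d| <= e], hence [`|z| <= 2 e]. *)
Lemma countable_separating (R : realType) (E : banachLatticeType R)
    (u : nat -> E) : exists g : nat -> dual E,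
  forall x y, closure (range (rat_comb u)) x ->
    closure (range (rat_comb u)) y -> (forall k, g k x = g k y) -> x = y.
Proof.
have /choice[h hP] : forall s, exists f : dual E,
    (forall z, f z <= `|z|) /\ f (rat_comb u s) = `|rat_comb u s|.
  move=> s; have [f [fc fn fs]] := norming_functional (rat_comb u s).
  by exists (Dual fc).
exists (fun k => h (odflt [::] (unpickle k))) => x y Sx Sy hxy.
have [S0 SD SZ] := closure_rat_comb_subspace u.
have Sxy : closure (range (rat_comb u)) (x - y).
  by rewrite -scaleN1r; apply: SD => //; exact: SZ.
apply/eqP; rewrite -subr_eq0 -normr_le0; apply/ler_addgt0Pr => e e0.
rewrite add0r; have e2 : 0 < e / 2 by rewrite divr_gt0.
have [_ [[s _ <-]]] := Sxy _ (nbhsx_ballx (x - y) _ e2).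
rewrite -ball_normE/= => se.
have [hn hs] := hP s.
have hs0 : h s (x - y) = 0.
  by have := hxy (pickle s); rewrite pickleK linearB/= => ->; rewrite subrr.
have := hn (rat_comb u s - (x - y)); rewrite linearB/= hs hs0 subr0 distrC.
have := ler_normD (x - y - rat_comb u s) (rat_comb u s); rewrite subrK.
lra.
Qed.

Theorem theorem2p4 (R : realType) (E : banachLatticeType R) (K : set E)
  (hK : absw_compact K) : absw_seq_compact K.
Proof.
move=> u uK; pose v : nat -> absw E := u.
have [g g_sep] := countable_separating u.
have [l [Kl vl]] : exists l : absw E, K l /\ cluster (v @ \oo) l.
  have [|l [Kl vl]] := hK (v @ \oo); last by exists l.
  by exists 0%N => // n _; exact: uK.
have [phi phi_lt gphi] := @cluster_subsequence R (absw E) v l (fun k => g k)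
  (fun k e => nbhs_absw (g k) l (e := e)) vl.
have vphi : (v \o phi) @ \oo --> v @ \oo.
  by apply: cvg_comp (cvg_increasing phi_lt) _; exact: cvg_id.
exists phi; split=> //; exists l => //.
apply: cvg_unique_cluster hK _ _ => [|l' phil'].
  by exists 0%N => // n _; exact: uK.
apply: g_sep.
- by apply: absw_cluster_closed_span; exact: cvg_cluster phil'.
- exact: absw_cluster_closed_span.
move=> k; apply/eqP; rewrite -subr_eq0 -normr_le0.
apply/ler_addgt0Pr => e e0; rewrite add0r.
have e2 : 0 < e / 2 by rewrite divr_gt0.
have [|y [gky gky']] := phil' [set y | `|g k l - g k y| < e / 2] _ _
  (nbhs_absw (g k) l' e2).
  by have /cvgrPdist_lt/(_ _ e2) := gphi k.
rewrite (le_trans (ler_distD (g k y) _ _))// (splitr e) lerD// ltW//.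
  by rewrite distrC.
by rewrite distrC.
Qed.
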